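(* For every $h$ with $0\le h\le g-1$, the locus $\theta_0^h$ is set-theoretically defined by the equations $$\theta\left[\begin{matrix}0\\ 0\end{matrix}\right](\tau,0)=0\quad\text{and}\quad \mathcal{B}\left(\left[\begin{matrix}0\\ 0\end{matrix}\right],\left[\begin{matrix}\varepsilon\\ \delta\end{matrix}\right]\right)^{h+1}(\tau)=0\quad\text{for all even } [\varepsilon,\delta]\neq[0,0].$$
   Context: $\mathcal{H}_g$ is the Siegel upper half-space of symmetric complex $g\times g$ matrices with positive definite imaginary part, on which $\operatorname{Sp}(2g,\mathbb{Z})$ acts by $\begin{pmatrix} a&b\\ c&d\end{pmatrix}\circ\tau=(a\tau+b)(c\tau+d)^{-1}$. $\Gamma_g(4,8)$ is the subgroup of matrices $M=\begin{pmatrix} a&b\\ c&d\end{pmatrix}\in\operatorname{Sp}(2g,\mathbb{Z})$ with $M\equiv 1 \bmod 4$ and $\operatorname{diag}(a\,{}^tb)\equiv\operatorname{diag}(c\,{}^td)\equiv 0\bmod 8$, and $\mathcal{A}_g(4,8)=\mathcal{H}_g/\Gamma_g(4,8)$. For $\varepsilon,\delta\in(\mathbb{Z}/2\mathbb{Z})^g$ (thought of as vectors of zeros and ones), $\tau\in\mathcal{H}_g$, $z\in\mathbb{C}^g$, $$\theta\left[\begin{matrix}\varepsilon\\ \delta\end{matrix}\right](\tau,z)=\sum_{m\in\mathbb{Z}^g}\exp \pi i\left[{}^t\left(m+\tfrac{\varepsilon}{2}\right)\tau\left(m+\tfrac{\varepsilon}{2}\right)+2\,{}^t\left(m+\tfrac{\varepsilon}{2}\right)\left(z+\tfrac{\delta}{2}\right)\right],$$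 and the theta constant is $\theta\left[\begin{matrix}\varepsilon\\ \delta\end{matrix}\right](\tau)=\theta\left[\begin{matrix}\varepsilon\\ \delta\end{matrix}\right](\tau,0)$. The characteristic $[\varepsilon,\delta]$ is even if $\varepsilon\cdot\delta=0\in\mathbb{Z}/2\mathbb{Z}$. $\theta_0\subset\mathcal{A}_g(4,8)$ is the divisor $\left\{\theta\left[\begin{matrix}0\\0\end{matrix}\right](\tau)=0\right\}$, and $\theta_0^h\subset\theta_0$ is the set of those $\tau\in\theta_0$ for which the $g\times g$ Hessian matrix $\left(\partial^2\theta\left[\begin{matrix}0\\0\end{matrix}\right](\tau,z)/\partial z_i\partial z_j|_{z=0}\right)_{i,j}$ has rank at most $h$. Let $\mathcal{D}$ be the symmetric $g\times g$ matrix of differential operators with entries $\mathcal{D}_{ij}=\frac{1+\delta_{i,j}}{2}\frac{\partial}{\partial\tau_{ij}}$, where $\delta_{i,j}$ is the Kronecker delta (so $\partial/\partial\tau_{ii}$ on the diagonal, $\frac12\partial/\partial\tau_{ij}$ off it). For even $[\varepsilon,\delta]\neq[0,0]$ consider the $g\times g$ matrix $$\theta\left[\begin{matrix}\varepsilon\\ \delta\end{matrix}\right](\tau)^2\,\mathcal{D}\left(\theta\left[\begin{matrix}0\\0\end{matrix}\right]\Big/\theta\left[\begin{matrix}\varepsilon\\ \delta\end{matrix}\right]\right)(\tau)=\theta\left[\begin{matrix}\varepsilon\\ \delta\end{matrix}\right](\tau)\,\mathcal{D}\theta\left[\begin{matrix}0\\0\end{matrix}\right](\tau)-\theta\left[\begin{matrix}0\\0\end{matrix}\right](\tau)\,\mathcal{D}\theta\left[\begin{matrix}\varepsilon\\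 \delta\end{matrix}\right](\tau),$$ where the right-hand side is the definition also at points where $\theta\left[\begin{matrix}\varepsilon\\ \delta\end{matrix}\right](\tau)=0$. Then $\mathcal{B}\left(\left[\begin{matrix}0\\ 0\end{matrix}\right],\left[\begin{matrix}\varepsilon\\ \delta\end{matrix}\right]\right)^{k}(\tau)$ denotes the $\binom gk\times\binom gk$ symmetric matrix of all $k\times k$ minors of this matrix, in lexicographic order; it is a vector-valued modular form for $\Gamma_g(4,8)$, so its vanishing is a well-defined condition on $\mathcal{A}_g(4,8)$. *)

(* Defs.v *)
From HB Require Import structures.
From mathcomp Require Import all_boot all_order all_algebra finmap complex.
From mathcomp Require Import all_classical all_reals all_analysis.
From mathcomp Require Import showcase.summability.

Set Implicit Arguments.
Unset Strict Implicit.
Unset Printing Implicit Defensive.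

Import Order.TTheory GRing.Theory Num.Theory numFieldNormedType.Exports.

Local Open Scope classical_set_scope.
Local Open Scope ring_scope.
Local Open Scope complex_scope.

Section SiegelSpace.
Variables (R : realType) (g : nat).
Local Notation C := R[i].

Definition siegel : set 'M[C]_g :=
  [set tau | tau^T = tau /\
     forall x : 'cV[R]_g, x != 0 ->
       0 < (x^T *m map_mx (@complex.Im R) tau *m x) 0 0].

Definition sympl_form : 'M[int]_(g + g) := block_mx 0 1%:M (- 1%:M) 0.

Definition Sp2Z : set 'M[int]_(g + g) :=
  [set M | M *m sympl_form *m M^T = sympl_form].

Definition Gamma48 : set 'M[int]_(g + g) :=
  [set M | [/\ Sp2Z M,
     forall i j, (M i j = (1%:M : 'M[int]_(g + g)) i j %[mod 4])%Z,
     forall i, (8 %| (ulsubmx M *m (ursubmx M)^T) i i)%Z &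
     forall i, (8 %| (dlsubmx M *m (drsubmx M)^T) i i)%Z]].

Definition sp_act (M : 'M[int]_(g + g)) (tau : 'M[C]_g) : 'M[C]_g :=
  let M' : 'M[C]_(g + g) := map_mx intr M in
  (ulsubmx M' *m tau + ursubmx M') *m invmx (dlsubmx M' *m tau + drsubmx M').

Definition Gamma48_orbit (tau : 'M[C]_g) : set 'M[C]_g :=
  [set sp_act M tau | M in Gamma48].

(* A point of the quotient of the half-space by Gamma_g(4,8) is an orbit. *)
Definition Ag48 : set (set 'M[C]_g) := Gamma48_orbit @` siegel.

End SiegelSpace.

Section Theta.
Variables (R : realType) (g : nat).
Local Notation C := R[i].

Definition cexp (z : C) : C :=
  (expR (complex.Re z))%:C * (cos (complex.Im z) +i* sin (complex.Im z)).

(* eps/2, with the entries of eps lifted to 0 or 1 *)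
Definition half_char (eps : 'cV['Z_2]_g) : 'cV[C]_g :=
  2^-1 *: map_mx (fun e : 'Z_2 => (nat_of_ord e)%:R) eps.

Definition theta_term (eps del : 'cV['Z_2]_g) (tau : 'M[C]_g) (z : 'cV[C]_g)
    (m : 'cV[int]_g) : C^o :=
  let u : 'cV[C]_g := map_mx intr m + half_char eps in
  cexp ((pi : R)%:C * 'i%C *
    ((u^T *m tau *m u) 0 0 + 2 * (u^T *m (z + half_char del)) 0 0)).

(* [sum] is the unordered sum: the limit of the sums over finite subsets of the
   index type, along inclusion.  The values are in C^o, C as a normed module
   over itself, so that the derivatives below are complex derivatives. *)
Definition theta (eps del : 'cV['Z_2]_g) (tau : 'M[C]_g) (z : 'cV[C]_g) : C^o :=
  sum (theta_term eps del tau z).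

Definition theta_const (eps del : 'cV['Z_2]_g) (tau : 'M[C]_g) : C^o :=
  theta eps del tau 0.

Definition even_char (eps del : 'cV['Z_2]_g) : bool :=
  \sum_i eps i 0 * del i 0 == 0.

Definition theta_hessian (eps del : 'cV['Z_2]_g) (tau : 'M[C]_g) : 'M[C]_g :=
  \matrix_(i, j)
    'D_(delta_mx i 0) (fun z => 'D_(delta_mx j 0) (theta eps del tau) z) 0.

(* On symmetric matrices the coordinates are the tau_ij with i <= j, so moving
   tau_ij moves the entries (i, j) and (j, i) together. *)
Definition dtau (i j : 'I_g) (f : 'M[C]_g -> C^o) (tau : 'M[C]_g) : C :=
  'D_(if i == j then delta_mx i i else delta_mx i j + delta_mx j i) f tau.

Definition Dop (f : 'M[C]_g -> C^o) (tau : 'M[C]_g) : 'M[C]_g :=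
  \matrix_(i, j) ((1 + (i == j)%:R) / 2 * dtau i j f tau).

End Theta.

(* Strictly increasing k-tuples represent the k-element subsets of 'I_g. *)
Definition incr_tuples (g k : nat) : {set k.-tuplelexi 'I_g} :=
  [set t : k.-tuplelexi 'I_g | sorted ltn (map val (t : k.-tuple 'I_g))].

Lemma card_incr_tuples (g k : nat) : #|incr_tuples g k| = 'C(g, k).
Proof. exact: card_ltn_sorted_tuples. Qed.

(* The a-th k-subset in lexicographic order; [Order.enum_val] enumerates
   increasingly. *)
Definition lex_subset (g k : nat) (a : 'I_('C(g, k))) : k.-tuple 'I_g :=
  Order.enum_val (cast_ord (esym (card_incr_tuples g k)) a).

Definition minors_mx (K : comNzRingType) (g k : nat) (A : 'M[K]_g) :
    'M[K]_('C(g, k)) :=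
  \matrix_(a, b) \det (mxsub (tnth (lex_subset a)) (tnth (lex_subset b)) A).

Section Loci.
Variables (R : realType) (g : nat).
Local Notation C := R[i].

Definition Bform (eps del : 'cV['Z_2]_g) (k : nat) (tau : 'M[C]_g) :
    'M[C]_('C(g, k)) :=
  minors_mx k
    (theta_const eps del tau *: Dop (theta_const 0 0) tau
     - theta_const 0 0 tau *: Dop (theta_const eps del) tau).

(* The locus of those points of the quotient which have a representative in the
   half-space satisfying P.  When P is invariant under Gamma_g(4,8), every
   representative then satisfies P. *)
Definition Ag48_locus (P : 'M[C]_g -> Prop) : set (set 'M[C]_g) :=
  [set x | Ag48 x /\
     exists tau, [/\ siegel tau, Gamma48_orbit tau = x & P tau]].

Definition hessian_rank_le (h : nat) (tau : 'M[C]_g) : Prop :=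
  theta_const 0 0 tau = 0 /\ (\rank (theta_hessian 0 0 tau) <= h)%N.

Definition theta0_rank (h : nat) : set (set 'M[C]_g) :=
  Ag48_locus (hessian_rank_le h).

End Loci.

(* Main.v *)
(* Where theta[0,0](tau) = 0, the matrix whose minors make up B is
   theta[eps,del](tau) * D theta[0,0](tau), and by the heat equation
   D theta[0,0](tau) is the Hessian divided by 4 pi i.  Hence theta_0^h is cut
   out by the stated equations as soon as some even theta constant other than
   theta[0,0] is nonzero at tau.  In fact the theta[0,del](tau) cannot all
   vanish: if they do, averaging over del shows that
   sum over v in u + 2 Z^g of exp(pi i v tau v) is 0 for every u.  Grouping the
   square of S(z) = sum over m of exp(pi i (2 m tau m + 2 m z)) by the value
   u = m + n then gives S(z)^2 = 0 for every real z, although the constant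
   Fourier coefficient of S is 1. *)

Require Import Defs.
From HB Require Import structures.
From mathcomp Require Import all_boot all_order all_algebra finmap complex.
From mathcomp Require Import all_classical all_reals all_analysis.
From mathcomp Require Import showcase.summability.
From mathcomp Require Import perm ring lra zify.

Import Order.TTheory GRing.Theory Num.Theory numFieldNormedType.Exports.

Local Open Scope classical_set_scope.
Local Open Scope ring_scope.
Local Open Scope complex_scope.

Set Implicit Arguments.
Unset Strict Implicit.
Unset Printing Implicit Defensive.

(** The derivatives in the statement are limits of difference quotients of an unordered sum, so the
    heat equation requires termwise differentiation. Moving z or tau by h in a fixed direction
    multiplies the m-th term by exp(h b(m)), where b(m) is at most a multiple of |m|^2, while the
    terms themselves decay like a Gaussian in m. One second-order estimate of exp therefore handles
    both z-derivatives of the Hessian and the tau-derivative. The constant Fourier coefficient of S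
    is extracted without integrating over a torus: averages over half-integer translates of z are
    finite sums, and absolute summability controls what is left. *)

Section Normc.
Variable R : realType.
Implicit Types z w : R[i].
Local Notation normc := (@Normc.normc R).

Lemma normcE z : `|z| = (normc z)%:C.
Proof. by case: z. Qed.

Lemma normc_ge0 z : 0 <= normc z.
Proof. by rewrite -lecR -normcE normr_ge0. Qed.

Lemma normcD z w : normc (z + w) <= normc z + normc w.
Proof. by rewrite -lecR rmorphD /= -!normcE ler_normD. Qed.

Lemma normcN z : normc (- z) = normc z.
Proof. exact: complex.normcN. Qed.

Lemma normc_sum (I : Type) (r : seq I) (f : I -> R[i]) :
  normc (\sum_(i <- r) f i) <= \sum_(i <- r) normc (f i).
Proof.
elim/big_ind2: _ => [|x1 x2 y1 y2 h1 h2|//]; first by rewrite Normc.normc0.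
by rewrite (le_trans (normcD _ _))// lerD.
Qed.

Lemma normc_real (x : R) : normc x%:C = `|x|.
Proof. by rewrite /= expr0n /= addr0 sqrtr_sqr. Qed.

Lemma normc_ge_Re z : `|complex.Re z| <= normc z.
Proof. by rewrite -lecR -normcE; exact: complex.normc_ge_Re. Qed.

Lemma normci : normc 'i = 1.
Proof. by rewrite /= expr0n /= add0r expr1n sqrtr1. Qed.

Lemma normc_ge_Im z : `|complex.Im z| <= normc z.
Proof.
rewrite -normrN -ReiNIm (le_trans (normc_ge_Re _))//.
by rewrite Normc.normcM normci mulr1.
Qed.

Lemma normc_le z : normc z <= `|complex.Re z| + `|complex.Im z|.
Proof.
rewrite {1}[z]complexE (le_trans (normcD _ _))//.
by rewrite Normc.normcM normci mul1r !normc_real.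
Qed.

Lemma normc_eq0 z : (forall e : R, 0 < e -> normc z <= e) -> z = 0.
Proof.
move=> h; apply: Normc.eq0_normc; apply/eqP; rewrite eq_le normc_ge0 andbT.
by apply/ler_addgt0Pl => e e0; rewrite addr0; exact: h.
Qed.

End Normc.

(** * Unordered sums of complex families *)

Section Sums.
Variable R : realType.
Local Notation C := R[i].
Local Notation normc := (@Normc.normc R).

(** A relation rather than a value: [sum] is a [lim], which returns a default when nothing
    converges. Convergence is carried by this relation and traded for [sum] only through
    [has_sum_sum]. *)
Definition has_sum (I : choiceType) (f : I -> C) (s : C) : Prop :=
  forall e : R, 0 < e -> exists A : {fset I}, forall B : {fset I},
    (A `<=` B)%fset -> normc (\sum_(i <- B) f i - s) <= e.

Definition abs_summable (I : choiceType) (f : I -> C) : Prop :=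
  exists M : R, forall B : {fset I}, \sum_(i <- B) normc (f i) <= M.

Section OneIndex.
Variable I : choiceType.
Implicit Types (f g : I -> C) (s t : C).

Lemma has_sum_eq f g s : f =1 g -> has_sum f s -> has_sum g s.
Proof. by move=> /funext ->. Qed.

Lemma has_sum_norm_le f s (M : R) :
  (forall B : {fset I}, \sum_(i <- B) normc (f i) <= M) ->
  has_sum f s -> normc s <= M.
Proof.
move=> hM hs; apply/ler_addgt0Pl => e e0; have [A hA] := hs e e0.
have := hA A (fsubset_refl _); set S := \sum_(i <- A) f i => h.
have -> : s = - (S - s) + S by ring.
rewrite (le_trans (normcD _ _))// lerD ?normcN//.
exact: (le_trans (normc_sum _ _)).
Qed.

Lemma has_sumD f g s t :
  has_sum f s -> has_sum g t -> has_sum (fun i => f i + g i) (s + t).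
Proof.
move=> hf hg e e0; have e2 : 0 < e / 2 by lra.
have [A hA] := hf _ e2; have [B hB] := hg _ e2.
exists (A `|` B)%fset => D; rewrite fsubUset => /andP[AD BD].
rewrite big_split /=; set F := \sum_(i <- D) f i; set G := \sum_(i <- D) g i.
have -> : F + G - (s + t) = (F - s) + (G - t) by ring.
by rewrite (le_trans (normcD _ _))// [leRHS]splitr lerD ?hA ?hB.
Qed.

Lemma has_sumZ a f s : has_sum f s -> has_sum (fun i => a * f i) (a * s).
Proof.
move=> hf e e0.
have a1 : 0 < normc a + 1 by rewrite ltr_wpDl ?normc_ge0.
have [A hA] := hf _ (divr_gt0 e0 a1).
exists A => B /hA h; rewrite -mulr_sumr -mulrBr Normc.normcM.
rewrite (le_trans (ler_wpM2l (normc_ge0 _) h))//.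
rewrite mulrC mulrAC ler_pdivrMr// ler_wpM2l ?ltW//.
by rewrite ltrDl.
Qed.

Lemma has_sumN f s : has_sum f s -> has_sum (fun i => - f i) (- s).
Proof.
move=> /(has_sumZ (-1)); rewrite mulN1r.
by apply: has_sum_eq => i; rewrite mulN1r.
Qed.

Lemma has_sumB f g s t :
  has_sum f s -> has_sum g t -> has_sum (fun i => f i - g i) (s - t).
Proof. by move=> hf /has_sumN; exact: has_sumD. Qed.

Lemma has_sum_fin (J : Type) (r : seq J) (f : J -> I -> C) (s : J -> C) :
  (forall j, has_sum (f j) (s j)) ->
  has_sum (fun i => \sum_(j <- r) f j i) (\sum_(j <- r) s j).
Proof.
move=> h; elim: r => [|j r ih].
  rewrite big_nil => e e0; exists fset0 => B _.
  by rewrite big1 ?subr0 ?Normc.normc0 ?ltW// => i _; rewrite big_nil.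
rewrite big_cons; apply: has_sum_eq (has_sumD (h j) ih) => i.
by rewrite big_cons.
Qed.

Lemma has_sum_unique f s t : has_sum f s -> has_sum f t -> s = t.
Proof.
move=> hs ht; apply/eqP; rewrite -subr_eq0; apply/eqP.
apply: normc_eq0 => e e0.
apply: has_sum_norm_le (has_sumB hs ht) => B.
by rewrite big1 ?ltW// => i _; rewrite subrr Normc.normc0.
Qed.

Lemma has_sum_sum f s : has_sum f s -> sum (f : I -> C^o) = s.
Proof.
move=> hf; have ? := @totally_filter I.
apply: (@cvg_lim C^o); first exact: norm_hausdorff.
apply/(@cvgrPdist_le C C^o) => /= e e0.
have [r er] : exists r : R, e = r%:C.
  by exists (complex.Re e); rewrite RRe_real// gtr0_real.
move: e0; rewrite {e}er ltcR => r0.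
have [A hA] := hf _ r0; exists A => //= B AB.
rewrite distrC normcE lecR; have := hA B AB.
by rewrite big_seq_fsetE.
Qed.

(** Take A whose sum of moduli is within e of the supremum over all finite sets; a set disjoint from
    A can then add at most e. *)
Lemma abs_summable_tail f (e : R) : abs_summable f -> 0 < e ->
  exists A : {fset I}, forall B : {fset I}, (A `&` B)%fset = fset0 ->
    \sum_(i <- B) normc (f i) <= e.
Proof.
move=> [M hM] e0.
pose E : set R := [set x | exists B : {fset I}, x = \sum_(i <- B) normc (f i)].
have supE : has_sup E.
  split; first by exists (\sum_(i <- fset0) normc (f i)), fset0.
  by exists M => _ [B ->].
have [_ [A ->] hA] := sup_adherent e0 supE.
exists A => B AB.
have : \sum_(i <- (A `|` B)%fset) normc (f i) <= sup E.
  by apply: ub_le_sup; [exact: supE.2 | exists (A `|` B)%fset].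
have -> : \sum_(i <- (A `|` B)%fset) normc (f i) =
   \sum_(i <- A) normc (f i) + \sum_(i <- B) normc (f i).
  rewrite (big_fsetID _ (mem A)) /=; congr (_ + _); apply: eq_fbigl => i.
    by rewrite !inE; case: (i \in A); rewrite ?andbF.
  rewrite !inE; case iA : (i \in A); rewrite ?andbT ?andbF //=.
  apply/esym/negP => iB; have : i \in (A `&` B)%fset by rewrite inE iA.
  by rewrite AB inE.
lra.
Qed.

Lemma abs_summable_le f g :
  (forall i, normc (f i) <= normc (g i)) -> abs_summable g -> abs_summable f.
Proof.
by move=> fg [M hM]; exists M => B; rewrite (le_trans _ (hM B))// ler_sum.
Qed.

Lemma abs_summable_has_sum_ge0 (f : I -> R) : (forall i, 0 <= f i) ->
  abs_summable (fun i => (f i)%:C) -> exists s, has_sum (fun i => (f i)%:C) s.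
Proof.
move=> f0 [M hM].
have sumE (B : {fset I}) : \sum_(i <- B) normc (f i)%:C = \sum_(i <- B) f i.
  by apply: eq_bigr => i _; rewrite normc_real ger0_norm.
pose E : set R := [set x | exists B : {fset I}, x = \sum_(i <- B) f i].
have supE : has_sup E.
  split; first by exists (\sum_(i <- fset0) f i), fset0.
  by exists M => _ [B ->]; rewrite -sumE.
exists (sup E)%:C => e e0.
have [_ [A ->] hA] := sup_adherent e0 supE.
exists A => B AB; rewrite -rmorph_sum -rmorphB normc_real distrC ger0_norm.
  have : \sum_(i <- A) f i <= \sum_(i <- B) f i.
    rewrite [leRHS](big_fsetID _ (mem A)) /=.
    rewrite [X in X + _](_ : _ = \sum_(i <- A) f i); last first.
      apply: eq_fbigl => i; rewrite !inE.
      by case iA : (i \in A); rewrite ?andbF// (fsubsetP AB).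
    by rewrite lerDl sumr_ge0.
  lra.
by rewrite subr_ge0; apply: ub_le_sup; [exact: supE.2 | exists B].
Qed.

(** Reduction to nonnegative families, where the sum is a supremum: a real family p is (p + |p|) -
    |p|, and a complex one splits into real and imaginary parts. *)
Lemma abs_summable_has_sum f : abs_summable f -> exists s, has_sum f s.
Proof.
move=> fs.
have real_case (p : I -> R) : (forall i, `|p i| <= normc (f i)) ->
    exists s, has_sum (fun i => (p i)%:C) s.
  move=> pf; have [M hM] := fs.
  have [||s hs] := @abs_summable_has_sum_ge0 (fun i => p i + `|p i|).
  - by move=> i; have := ler_norm (- p i); rewrite normrN; lra.
  - exists (M + M) => B.
    apply: (@le_trans _ _ (\sum_(i <- B) (normc (f i) + normc (f i)))).
      apply: ler_sum => j _; rewrite normc_real (le_trans (ler_normD _ _))//.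
      by rewrite normr_id lerD.
    by rewrite big_split lerD.
  have [||t ht] := @abs_summable_has_sum_ge0 (fun i => `|p i|).
  - by [].
  - by apply: abs_summable_le fs => j; rewrite normc_real normr_id.
  exists (s - t); apply: has_sum_eq (has_sumB hs ht) => j.
  by rewrite -rmorphB /= addrK.
have [s hs] := real_case (fun i => complex.Re (f i)) (fun i => normc_ge_Re _).
have [t ht] := real_case (fun i => complex.Im (f i)) (fun i => normc_ge_Im _).
exists (s + 'i * t); apply: has_sum_eq (has_sumD hs (has_sumZ 'i ht)) => i.
by rewrite -complexE.
Qed.

Lemma abs_summableZ a f : abs_summable f -> abs_summable (fun i => a * f i).
Proof.
move=> [M hM]; exists (normc a * M) => B.
under eq_bigr do rewrite Normc.normcM.
by rewrite -mulr_sumr ler_wpM2l ?normc_ge0.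
Qed.

End OneIndex.

Section TwoIndices.
Variables I J : choiceType.

Lemma abs_summable_comp_inj (p : I -> J) (f : J -> C) :
  injective p -> abs_summable f -> abs_summable (f \o p).
Proof.
move=> inj_p [M hM]; exists M => B.
rewrite (le_trans _ (hM (p @` B)%fset))// big_imfset//=.
by move=> x y _ _; exact: inj_p.
Qed.

(** Once B contains q(A), summing over p(B) or over its union with A gives the same value: an
    element of A missing from p(B) cannot lie in the image of p, so f vanishes there. *)
Lemma has_sum_comp_can (p : I -> J) (q : J -> I) (f : J -> C) s :
  cancel p q -> (forall j, p (q j) != j -> f j = 0) ->
  has_sum f s -> has_sum (f \o p) s.
Proof.
move=> pK f0 hf e e0; have [A hA] := hf e e0.
exists (q @` A)%fset => B AB.
have inj_p : injective p := can_inj pK.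
have -> : \sum_(i <- B) (f \o p) i = \sum_(j <- (A `|` (p @` B))%fset) f j.
  have -> : \sum_(i <- B) (f \o p) i = \sum_(j <- (p @` B)%fset) f j.
    by rewrite big_imfset//= => x y _ _; exact: inj_p.
  apply: big_fset_incl; first exact: fsubsetUr.
  move=> j; rewrite inE => /orP[jA jB|-> //].
  apply: f0; apply: contra jB => /eqP <-; apply: in_imfset => /=.
  by apply: (fsubsetP AB); exact: in_imfset.
by apply: hA; exact: fsubsetUl.
Qed.

Lemma abs_summable_prod (f : I -> C) (g : J -> C) :
  abs_summable f -> abs_summable g ->
  abs_summable (fun x : I * J => f x.1 * g x.2).
Proof.
move=> [M hM] [N hN]; exists (M * N) => B.
have N0 : 0 <= N by have := hN fset0; rewrite big_seq_fset0.
rewrite (partition_big_imfset _ fst) /=.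
apply: (@le_trans _ _ (\sum_(i <- (fst @` B)%fset) normc (f i) * N)).
  apply: ler_sum => i _.
  rewrite (_ : \sum_(x <- B | x.1 == i) _ =
      normc (f i) * \sum_(x <- B | x.1 == i) normc (g x.2)); last first.
    rewrite mulr_sumr; apply: eq_bigr => x /eqP <-.
    by rewrite Normc.normcM.
  apply: ler_wpM2l; first exact: normc_ge0.
  rewrite (le_trans _ (hN (snd @` [fset x in B | x.1 == i])%fset))//.
  rewrite [leRHS]big_imfset /=; last first.
    move=> [x1 x2] [y1 y2]; rewrite !inE /=.
    by move=> /andP[_ /eqP ->] /andP[_ /eqP ->] ->.
  by rewrite big_fset_condE.
by rewrite -mulr_suml ler_wpM2r.
Qed.

End TwoIndices.

(** If B contains the first projections of A, the rows over B differ from the whole sum only by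
    terms outside A, and these form a tail of modulus at most e. *)
Lemma has_sum_sigma (I J : choiceType) (f : I * J -> C) s (t : I -> C) :
  abs_summable f -> has_sum f s ->
  (forall i, has_sum (fun j => f (i, j)) (t i)) -> has_sum t s.
Proof.
move=> fs hs ht e e0; have [A hA] := abs_summable_tail fs e0.
exists (fst @` A)%fset => B AB.
(* Each row is extended by zero to all of I * J, so that finitely many rows and the full sum can be
   subtracted as families over one index type. *)
have slice i0 : has_sum (fun x : I * J => f x * (x.1 == i0)%:R) (t i0).
  have /abs_summable_has_sum[u hu] :
      abs_summable (fun x : I * J => f x * (x.1 == i0)%:R).
    apply: abs_summable_le fs => x; case: eqP => _; rewrite ?mulr1//.
    by rewrite mulr0 Normc.normc0 normc_ge0.
  suff -> : t i0 = u by [].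
  apply: has_sum_unique (ht i0) _.
  have := has_sum_comp_can (p := pair i0) (q := snd) _ _ hu.
  move=> h; apply: has_sum_eq (h _ _) => //= [j|[i j]] /=.
    by rewrite eqxx mulr1.
  by case: (eqVneq i i0) => [->|]; rewrite ?eqxx ?mulr0.
have hB := has_sumB (has_sum_fin B slice) hs.
apply: has_sum_norm_le hB => D.
pose D' := [fset x in D | x.1 \notin B]%fset.
rewrite (le_trans _ (hA D' _))//; last first.
  apply/fsetP => x; rewrite !inE; apply/negP => /and3P[xA _ /negP]; apply.
  by apply: (fsubsetP AB); exact: in_imfset.
rewrite -big_fset_condE [leRHS]big_mkcond /=; apply: ler_sum => x _.
have -> : \sum_(i <- B) f x * (x.1 == i)%:R = f x * (x.1 \in B)%:R.
  rewrite -mulr_sumr; congr (_ * _).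
  case: (boolP (x.1 \in B)) => xB.
    rewrite (big_fsetD1 x.1)//= eqxx big_seq big1 ?addr0// => i.
    by rewrite !inE eq_sym => /andP[/negbTE ->].
  rewrite big_seq big1// => i iB; case: eqP => // xi.
  by rewrite xi iB in xB.
case: (x.1 \in B) => /=; first by rewrite mulr1 subrr Normc.normc0.
by rewrite mulr0 sub0r normcN.
Qed.

End Sums.

(** * Exponentials and Gaussian families *)

Section Cexp.
Variable R : realType.
Implicit Types z w : R[i].
Local Notation normc := (@Normc.normc R).

Lemma cexpD z w : cexp (z + w) = cexp z * cexp w.
Proof.
case: z w => [a b] [c d]; rewrite /cexp /= expRD sinD cosD.
by apply/eqP; rewrite eq_complex /=; apply/andP; split; apply/eqP; ring.
Qed.

Lemma cexp0 : cexp (0 : R[i]) = 1.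
Proof. by rewrite /cexp /= expR0 cos0 sin0 mul1r. Qed.

Lemma normc_cexp z : normc (cexp z) = expR (complex.Re z).
Proof.
rewrite /cexp Normc.normcM normc_real ger0_norm ?expR_ge0//.
by rewrite /= cos2Dsin2 sqrtr1 mulr1.
Qed.

Lemma sin_norm_le (x : R) : `|sin x| <= `|x|.
Proof.
wlog x0 : x / 0 <= x => [h|].
  have [/h//|/ltW xle0] := leP 0 x.
  by rewrite -normrN -sinN -[leRHS]normrN h// oppr_ge0.
have [c _] := @MVT_segment R sin cos 0 x x0 (fun y _ => is_derive_sin y)
  (continuous_subspaceT (@continuous_sin R)).
rewrite sin0 !subr0 => ->; rewrite normrM ler_piMl//.
exact: cos_max.
Qed.

Lemma one_sub_cos (x : R) : 1 - cos x = 2 * sin (x / 2) ^+ 2.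
Proof.
rewrite {1}(_ : x = (x / 2) *+ 2); last by rewrite mulr2n -splitr.
rewrite cos_mulr2n; have := cos2Dsin2 (x / 2).
by rewrite !mulr2n; lra.
Qed.

Lemma cos_sub1_norm_le (x : R) : `|cos x - 1| <= x ^+ 2.
Proof.
rewrite distrC one_sub_cos normrM normrX normr_nat//.
have hs := sin_norm_le (x / 2).
rewrite (@le_trans _ _ (2 * `|x / 2| ^+ 2))//.
  by rewrite ler_wpM2l// lerXn2r ?nnegrE ?normr_ge0.
by rewrite real_normK ?num_real//; nra.
Qed.

Lemma sin_sub_norm_le (x : R) : `|sin x - x| <= x ^+ 2.
Proof.
wlog x0 : x / 0 <= x => [h|].
  have [/h//|/ltW xle0] := leP 0 x.
  by have := h (- x); rewrite oppr_ge0 sinN sqrrN -opprD normrN; exact.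
have [c cx] := @MVT_segment R sin cos 0 x x0 (fun y _ => is_derive_sin y)
  (continuous_subspaceT (@continuous_sin R)).
rewrite sin0 !subr0 => ->.
rewrite -{2}[x]mul1r -mulrBl normrM (ger0_norm x0) expr2 ler_wpM2r//.
move: cx; rewrite in_itv /= => /andP[c0 cx].
rewrite distrC one_sub_cos normrM normrX normr_nat//.
(* In 1 - cos c = 2 sin(c/2)^2, one factor sin(c/2) is bounded by c/2 and the other by 1, which
   leaves at most c <= x. *)
have := sin_norm_le (c / 2); rewrite [leRHS]ger0_norm ?divr_ge0// => hs.
have := sin_max (c / 2); have := normr_ge0 (sin (c / 2)).
set s := `|_| in hs *; nra.
Qed.

Lemma expR_sub1_norm_le (x : R) : `|expR x - 1| <= `|x| * expR `|x|.
Proof.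
have e1 := expR_ge1Dx x; have e2 := expR_ge1Dx (- x).
have e3 : 1 <= expR `|x| by rewrite -expR0 ler_expR.
have e4 : expR x * expR (- x) = 1 by exact: expRxMexpNx_1.
have [x0|x0] := ger0P x.
  rewrite ger0_norm; last by lra.
  rewrite ger0_norm// in e3; have := expR_gt0 x; nra.
rewrite ltr0_norm// in e3; rewrite ler0_norm; last first.
  by rewrite subr_le0 expR_le1 ltW.
nra.
Qed.

(** Multiplying 1 - x <= exp(-x) by exp x gives exp x - 1 <= x exp x, hence 0 <= exp x - 1 - x <= x
    (exp x - 1), and the first-order bound finishes. *)
Lemma expR_sub1D_norm_le (x : R) : `|expR x - 1 - x| <= `|x| ^+ 2 * expR `|x|.
Proof.
have e1 := expR_ge1Dx x; rewrite ger0_norm; last by lra.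
have := expR_sub1_norm_le x; rewrite ler_norml => /andP[e2 e3].
have e5 := expR_ge1Dx (- x).
have e4 : expR x * expR (- x) = 1 by exact: expRxMexpNx_1.
have e6 : expR x - 1 <= x * expR x by have := expR_gt0 x; nra.
rewrite (@le_trans _ _ (x * (expR x - 1)))//; first by nra.
rewrite (le_trans (ler_norm _))// normrM expr2 -mulrA ler_wpM2l//.
exact: expR_sub1_norm_le.
Qed.

Lemma normc_cexp_sub1D_le z :
  normc (cexp z - 1 - z) <= 4 * (normc z ^+ 2 * expR (normc z)).
Proof.
have hx := normc_ge_Re z; have hy := normc_ge_Im z.
have n0 := normc_ge0 z; set n := normc z in hx hy n0 *.
rewrite (le_trans (normc_le _))//.
set x := complex.Re z in hx *; set y := complex.Im z in hy *.
have -> : complex.Re (cexp z - 1 - z) = expR x * cos y - 1 - x.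
  by rewrite /x /y; case: (z) => a b /=; ring.
have -> : complex.Im (cexp z - 1 - z) = expR x * sin y - y.
  by rewrite /x /y; case: (z) => a b /=; ring.
have en : 1 <= expR n by rewrite -expR0 ler_expR.
have sq (t : R) : `|t| <= n -> t ^+ 2 <= n ^+ 2.
  by move=> h; rewrite -real_normK ?num_real// lerXn2r ?nnegrE.
have ex : expR x <= expR n by rewrite ler_expR (le_trans (ler_norm _)).
have exx : expR `|x| <= expR n by rewrite ler_expR.
have n2 : 0 <= n ^+ 2 by exact: sqr_ge0.
have a1 : `|expR x * cos y - 1 - x| <= 2 * (n ^+ 2 * expR n).
  rewrite (_ : _ - x = (expR x - 1 - x) + expR x * (cos y - 1)); last by ring.
  rewrite (le_trans (ler_normD _ _))// mulr_natl mulr2n lerD//.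
    rewrite (le_trans (expR_sub1D_norm_le _))// ler_pM ?expR_ge0//.
    by rewrite lerXn2r ?nnegrE.
  rewrite normrM ger0_norm ?expR_ge0// mulrC ler_pM ?expR_ge0//.
  by rewrite (le_trans (cos_sub1_norm_le _))// sq.
have a2 : `|expR x * sin y - y| <= 2 * (n ^+ 2 * expR n).
  rewrite (_ : _ - y = (expR x - 1) * y + expR x * (sin y - y)); last by ring.
  rewrite (le_trans (ler_normD _ _))// mulr_natl mulr2n lerD//.
    rewrite normrM expr2 mulrAC ler_pM ?mulr_ge0//.
    by rewrite (le_trans (expR_sub1_norm_le _))// ler_pM ?expR_ge0.
  rewrite normrM ger0_norm ?expR_ge0// mulrC ler_pM ?expR_ge0//.
  by rewrite (le_trans (sin_sub_norm_le _))// sq.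
by move: a1 a2; lra.
Qed.

End Cexp.

Section Gauss.
Variables (R : realType) (g : nat).
Local Notation C := R[i].
Local Notation normc := (@Normc.normc R).
Implicit Types (m : 'cV[int]_g) (f a b : 'cV[int]_g -> C).

Definition sqnorm m : R := \sum_i ((m i 0)%:~R : R) ^+ 2.

Lemma sqnorm_ge0 m : 0 <= sqnorm m.
Proof. by apply: sumr_ge0 => i _; exact: sqr_ge0. Qed.

(** Since k^2 >= |k|, comparison with a two-sided geometric series of ratio r. The induction needs
    the sharper bound with - 2 r^(K+1): the two new end terms cost at most 2 r^(K+1) (1 - r), which
    is exactly the change of that correction. *)
Lemma expR_sqr_int_sum_le (c : R) (K : nat) : 0 < c ->
  \sum_(k < (K.*2).+1) expR (- (c * ((k%:Z - K%:Z)%:~R : R) ^+ 2)) <=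
    2 / (1 - expR (- c)).
Proof.
move=> c0; set r := expR (- c).
have r0 : 0 < r := expR_gt0 _.
have r1 : r < 1 by rewrite expR_lt1 oppr_lt0.
rewrite ler_pdivlMr ?subr_gt0//.
suff: (\sum_(k < (K.*2).+1) expR (- (c * ((k%:Z - K%:Z)%:~R : R) ^+ 2)))
   * (1 - r) <= 2 - 2 * r ^+ K.+1.
  by have := exprn_gt0 K.+1 r0; lra.
elim: K => [|K ih].
  by rewrite big_ord1 subrr expr0n mulr0 oppr0 expR0 expr1; lra.
rewrite doubleS big_ord_recl big_ord_recr /=.
set S := \sum_(_ < _) _ in ih.
rewrite [X in _ + (X + _)](_ : _ = S); last first.
  apply: eq_bigr => k _; congr (expR (- (c * _ ^+ 2))); congr (_%:~R).
  by rewrite /bump /=; lia.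
have pw (d : int) : d = K.+1 \/ d = - K.+1%:Z ->
    expR (- (c * ((d%:~R : R) ^+ 2))) <= r ^+ K.+1.
  move=> hd; rewrite -expRM_natl ler_expR mulrN lerN2 mulrC.
  rewrite ler_wpM2l ?(ltW c0)//.
  have -> : (d%:~R : R) ^+ 2 = K.+1%:R ^+ 2.
    by case: hd => ->; rewrite ?mulrNz ?sqrrN.
  by rewrite expr2 ler_peMl// ler1n.
have h1 := pw (0%:Z - K.+1%:Z) (or_intror (sub0r _)).
have h2 : expR (- (c * (((bump 0 (K.*2).+1)%:Z - K.+1%:Z)%:~R : R) ^+ 2))
    <= r ^+ K.+1.
  by apply: pw; left; rewrite /bump /=; lia.
rewrite [r ^+ K.+2]exprS; have := exprn_gt0 K.+1 r0.
move: h1 h2 ih; set p := r ^+ K.+1; set u := expR _; set v := expR _.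
nra.
Qed.

(** A finite set of integer vectors lies in a box [-K, K]^g, and over the box the Gaussian sum is a
    product of g one-dimensional sums bounded uniformly in K. *)
Lemma gauss_abs_summable (c : R) : 0 < c ->
  abs_summable (fun m => (expR (- (c * sqnorm m)))%:C).
Proof.
move=> c0; exists ((2 / (1 - expR (- c))) ^+ g) => B.
under eq_bigr do rewrite normc_real (ger0_norm (expR_ge0 _)).
have [K hK] : exists K : nat, forall m i, m \in B -> (`|m i 0%R| <= K)%N.
  exists (\sum_(m <- B) \sum_i `|m i 0%R|)%N => m i mB.
  rewrite (big_fsetD1 m)//= (bigD1 i)//= -addnA.
  exact: leq_addr.
pose w (k : 'I_(K.*2).+1) : R := expR (- (c * ((k%:Z - K%:Z)%:~R : R) ^+ 2)).
pose phi m : {ffun 'I_g -> 'I_(K.*2).+1} :=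
  [ffun i => inord (absz (m i 0 + K%:Z))].
have phiE m i : m \in B -> (phi m i)%:Z - K%:Z = m i 0.
  move=> /(hK m i) h; rewrite ffunE inordK; lia.
have phi_inj : {in B &, injective phi}.
  move=> m n mB nB e; apply/matrixP => i j.
  by rewrite ord1 -(phiE m)// -(phiE n)// e.
rewrite (@le_trans _ _ (\prod_(i < g) \sum_(k < (K.*2).+1) w k))//; last first.
  rewrite -[X in _ ^+ X]card_ord -prodr_const; apply: ler_prod => i _.
  rewrite expR_sqr_int_sum_le// andbT sumr_ge0// => k _; exact: expR_ge0.
rewrite bigA_distr_bigA /=.
rewrite (_ : \sum_(m <- B) _ =
   \sum_(f <- (phi @` B)%fset) \prod_(i < g) w (f i)); last first.
  rewrite big_imfset//=; apply: eq_big_seq => m mB.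
  rewrite /sqnorm mulr_sumr -sumrN expR_sum.
  by apply: eq_bigr => i _; rewrite /w phiE.
rewrite big_uniq ?fset_uniq//= [leRHS](bigID (mem (phi @` B)%fset)) /=.
rewrite lerDl sumr_ge0// => f _; apply: prodr_ge0 => i _; exact: expR_ge0.
Qed.

End Gauss.

(** * Termwise differentiation of series with Gaussian decay *)

Section GaussBound.
Variables (R : realType) (g : nat).
Local Notation C := R[i].
Local Notation normc := (@Normc.normc R).
Local Notation sqnorm := (@sqnorm R g).
Implicit Types (m : 'cV[int]_g) (a b : 'cV[int]_g -> C).

Definition gauss_bounded a : Prop := exists K c : R, 0 < c /\
  forall m, normc (a m) <= K * expR (- (c * sqnorm m)).

Lemma gauss_bounded_summable a : gauss_bounded a -> abs_summable a.
Proof.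
move=> [K [c [c0 h]]].
apply: abs_summable_le (abs_summableZ K%:C (@gauss_abs_summable R g c c0)).
move=> m; rewrite (le_trans (h m))// Normc.normcM !normc_real.
by rewrite (ger0_norm (expR_ge0 _)) ler_wpM2r ?expR_ge0// ler_norm.
Qed.

Lemma gauss_bounded_le a b : (forall m, normc (a m) <= normc (b m)) ->
  gauss_bounded b -> gauss_bounded a.
Proof.
by move=> ab [K [c [c0 h]]]; exists K, c; split=> // m; exact: le_trans (h m).
Qed.

(** Half of the decay rate is spent on the factor q = |m|^2: from t <= exp t at t = c q / 2 one gets
    q exp(- c q / 2) <= 2 / c. *)
Lemma gauss_bounded_mul a b (L : R) : gauss_bounded a ->
  (forall m, normc (b m) <= L * sqnorm m) ->
  gauss_bounded (fun m => a m * b m).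
Proof.
move=> [K [c [c0 h]]] hb; exists (K * (`|L| * (2 / c))), (c / 2).
split=> [|m]; first by rewrite divr_gt0.
have K0 : 0 <= K.
  have := le_trans (normc_ge0 _) (h 0); rewrite pmulr_lge0// expR_gt0//.
rewrite Normc.normcM.
have hm := h m; set q := sqnorm m in hm *.
have q0 : 0 <= q := sqnorm_ge0 _ _.
apply: (@le_trans _ _ (K * expR (- (c * q)) * (`|L| * q))).
  rewrite ler_pM ?normc_ge0//.
  by rewrite (le_trans (hb m))// ler_wpM2r// ler_norm.
have -> : - (c * q) = - (c / 2 * q) + - (c / 2 * q) :> R by field.
rewrite expRD; set E := expR (- (c / 2 * q)).
have E0 : 0 < E := expR_gt0 _.
have qE : q * E <= 2 / c.
  rewrite /E expRN ler_pdivrMr ?expR_gt0//.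
  have {1}-> : q = 2 / c * (c / 2 * q) by field; rewrite gt_eqF.
  rewrite ler_wpM2l ?divr_ge0 ?(ltW c0)//.
  by rewrite (le_trans _ (expR_ge1Dx _))// lerDr.
rewrite (_ : _ * _ = K * `|L| * (q * E) * E); last by ring.
rewrite [X in _ <= X * _]mulrA ler_wpM2r ?(ltW E0)// ler_wpM2l//.
by rewrite mulr_ge0.
Qed.

Lemma gauss_bounded_exp a b (L : R) : gauss_bounded a ->
  (forall m, normc (b m) <= L * sqnorm m) ->
  exists r : R, 0 < r /\
    gauss_bounded (fun m => a m * (expR (r * normc (b m)))%:C).
Proof.
move=> [K [c [c0 h]]] hb; pose L' := `|L| + 1.
have L0 : 0 < L' by rewrite ltr_wpDl.
(* With this rate the new exponential is at most exp(c q / 2), so half of the decay survives. The +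
   1 in L' keeps the divisor positive. *)
exists (c / 2 / L'); split; first by rewrite !divr_gt0.
exists K, (c / 2); split=> [|m]; first by rewrite divr_gt0.
have K0 : 0 <= K.
  have := le_trans (normc_ge0 _) (h 0); rewrite pmulr_lge0// expR_gt0//.
rewrite Normc.normcM normc_real (ger0_norm (expR_ge0 _)).
have hm := h m; have hbm := hb m; set q := sqnorm m in hm hbm *.
have q0 : 0 <= q := sqnorm_ge0 _ _.
have -> : - (c / 2 * q) = - (c * q) + c / 2 * q :> R by field.
rewrite expRD mulrA ler_pM ?normc_ge0 ?expR_ge0// ler_expR.
rewrite -mulrA ler_wpM2l ?divr_ge0// ?(ltW c0)// mulrC ler_pdivrMr//.
rewrite (le_trans hbm)// mulrC ler_wpM2l//.
by rewrite (le_trans (ler_norm _))// lerDl.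
Qed.

(** Termwise, |a (exp(h b) - 1 - h b)| <= |h|^2 * 4 |a| |b|^2 exp(r |b|) as soon as |h| <= r. The
    right-hand family apart from |h|^2 is Gaussian bounded, so M is independent of h and division by
    h leaves an error linear in |h|. *)
Lemma sum_exp_diff_quotient a b (L : R) : gauss_bounded a ->
  (forall m, normc (b m) <= L * sqnorm m) ->
  exists r M : R, 0 < r /\ forall h : C, h != 0 -> normc h <= r ->
    normc (h^-1 * (sum ((fun m => a m * cexp (h * b m)) : _ -> C^o)
                   - sum (a : _ -> C^o))
           - sum ((fun m => a m * b m) : _ -> C^o)) <= normc h * M.
Proof.
move=> ha hb; have [r [r0 hr]] := gauss_bounded_exp ha hb.
have h2 := gauss_bounded_mul (gauss_bounded_mul hr hb) hb.
have [M hM] := abs_summableZ 4 (gauss_bounded_summable h2).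
exists r, M; split=> // h h0 hnr.
have [A hA] := abs_summable_has_sum (gauss_bounded_summable ha).
have [B hB] :=
  abs_summable_has_sum (gauss_bounded_summable (gauss_bounded_mul ha hb)).
have hh m : normc (h * b m) <= r * normc (b m).
  by rewrite Normc.normcM ler_wpM2r ?normc_ge0.
have [G hG] : exists s, has_sum (fun m => a m * cexp (h * b m)) s.
  apply/abs_summable_has_sum/gauss_bounded_summable.
  apply: gauss_bounded_le hr => m; rewrite !(Normc.normcM (a m)).
  rewrite ler_wpM2l ?normc_ge0// normc_cexp normc_real.
  rewrite (ger0_norm (expR_ge0 _)) ler_expR (le_trans _ (hh m))//.
  exact: le_trans (ler_norm _) (normc_ge_Re _).
rewrite (has_sum_sum hA) (has_sum_sum hB) (has_sum_sum hG).
have hS := has_sumB (has_sumB hG hA) (has_sumZ h hB).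
have n0 : 0 < normc h.
  rewrite lt_def normc_ge0 andbT; apply: contra h0 => /eqP.
  by move/Normc.eq0_normc ->.
suff le2 : normc (G - A - h * B) <= normc h ^+ 2 * M.
  rewrite (_ : _ - B = h^-1 * (G - A - h * B)); last by field.
  rewrite Normc.normcM Normc.normcV ler_pdivrMl// mulrA -expr2//.
apply: has_sum_norm_le hS => D.
rewrite (le_trans _ (ler_wpM2l (sqr_ge0 _) (hM D)))// mulr_sumr.
apply: ler_sum => m _.
have -> : a m * cexp (h * b m) - a m - h * (a m * b m) =
    a m * (cexp (h * b m) - 1 - h * b m).
  by move: (cexp (h * b m)) => x; ring.
rewrite !(Normc.normcM 4, Normc.normcM (a m), Normc.normcM (_ * b m)).
rewrite (Normc.normcM (a m * _)) (Normc.normcM (a m)).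
rewrite (_ : 4 = (4 : R)%:C); last by rewrite rmorph_nat.
rewrite ?normc_real ?(ger0_norm (expR_ge0 _)) ?normr_nat.
apply: (@le_trans _ _ (normc (a m) * (4 * (normc (h * b m) ^+ 2 *
   expR (r * normc (b m)))))).
  rewrite ler_wpM2l ?normc_ge0// (le_trans (normc_cexp_sub1D_le _))//.
  by rewrite ler_wpM2l// ler_wpM2l ?sqr_ge0// ler_expR.
rewrite Normc.normcM le_eqVlt; apply/orP; left; apply/eqP. ring.
Qed.

Lemma derive_eq (V : normedModType C) (f : V -> C^o) (p v : V) (T : C)
    (r M : R) : 0 < r ->
  (forall h : C, h != 0 -> normc h <= r ->
     normc (h^-1 * (f (h *: v + p) - f p) - T) <= normc h * M) ->
  'D_v f p = T.
Proof.
move=> r0 hr; apply: (@cvg_lim C^o); first exact: norm_hausdorff.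
apply/(@cvgrPdist_le C C^o) => /= e e0.
have [u eu] : exists u : R, e = u%:C.
  by exists (complex.Re e); rewrite RRe_real// gtr0_real.
move: e0; rewrite {e}eu ltcR => u0.
have M0 : 0 < `|M| + 1 by rewrite ltr_wpDl.
pose d := Num.min r (u / (`|M| + 1)).
have d0 : 0 < d by rewrite lt_min r0 divr_gt0.
near=> h.
have h0 : h != 0 by near: h; exact: (@nbhs_dnbhs_neq C^o 0).
have hd : normc h <= d.
  rewrite -lecR -normcE; near: h; apply: (@dnbhs0_le C C^o).
  by rewrite ltcR.
move: hd; rewrite le_min => /andP[h1 h2].
rewrite distrC normcE lecR (le_trans (hr h h0 h1))//.
rewrite (@le_trans _ _ (normc h * (`|M| + 1)))//.
  by rewrite ler_wpM2l ?normc_ge0// (le_trans (ler_norm _))// lerDl.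
by rewrite -ler_pdivlMr.
Unshelve. all: by end_near. Qed.

(** The common form of all derivatives taken below: v is a direction in the z-space or in the
    tau-space, and b is the logarithmic derivative of the m-th term along v. *)
Lemma derive_exp_series (V : normedModType C) (f : V -> C^o) (p v : V)
    a b (L d : R) : gauss_bounded a ->
  (forall m, normc (b m) <= L * sqnorm m) -> 0 < d ->
  (forall h : C, normc h <= d ->
     f (h *: v + p) = sum ((fun m => a m * cexp (h * b m)) : _ -> C^o)) ->
  'D_v f p = sum ((fun m => a m * b m) : _ -> C^o).
Proof.
move=> ha hb d0 hf; have [r [M [r0 hr]]] := sum_exp_diff_quotient ha hb.
apply: (@derive_eq _ _ _ _ _ (Num.min r d) M); first by rewrite lt_min r0.
move=> h h0; rewrite le_min => /andP[h1 h2].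
have -> : f p = sum (a : _ -> C^o).
  have := hf 0; rewrite scale0r add0r => ->; last by rewrite Normc.normc0 ltW.
  by congr sum; apply/funext => m; rewrite mul0r cexp0 mulr1.
by rewrite hf// hr.
Qed.

End GaussBound.

(** * Theta series at a point of the Siegel space *)

Section PosDef.
Variables (R : realType) (g : nat).

(** An explicit constant replaces compactness of the sphere: x_i^2 <= (Y^-1)_ii Q(x), and summing
    over i gives c = 1 / (1 + tr Y^-1). The 1 keeps the denominator positive when g = 0. *)
Lemma posdef_lower_bound (Y : 'M[R]_g) : Y^T = Y ->
  (forall x : 'cV[R]_g, x != 0 -> 0 < (x^T *m Y *m x) 0 0) ->
  exists c : R, 0 < c /\
    forall x : 'cV[R]_g, c * \sum_i x i 0 ^+ 2 <= (x^T *m Y *m x) 0 0.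
Proof.
move=> YT Ypos.
have Yge0 (x : 'cV[R]_g) : 0 <= (x^T *m Y *m x) 0 0.
  by have [->|/Ypos/ltW//] := eqVneq x 0; rewrite mulmx0 mxE.
have Yunit : Y \in unitmx.
  rewrite unitmxE unitfE; apply/negP => /det0P[v v0 vY].
  have vT0 : v^T != 0.
    by apply: contra v0 => /eqP vT; rewrite -[v]trmxK vT trmx0.
  by have := Ypos _ vT0; rewrite trmxK vY mul0mx mxE ltxx.
pose d i : R := invmx Y i i.
pose w i : 'cV[R]_g := invmx Y *m delta_mx i 0.
have Yw i : Y *m w i = delta_mx i 0 by rewrite mulmxA mulmxV ?mul1mx.
have dotl (x : 'cV[R]_g) i : (x^T *m (delta_mx i 0 : 'cV[R]_g)) 0 0 = x i 0.
  by rewrite -colE !mxE.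
have wYE (x : 'cV[R]_g) i : ((w i)^T *m Y *m x) 0 0 = x i 0.
  rewrite -{1}YT -trmx_mul Yw trmx_delta.
  by rewrite -rowE !mxE.
have wi i : (w i) i 0 = d i by rewrite /w -colE mxE.
have d0 i : 0 < d i.
  rewrite -wi -wYE; apply: Ypos; apply/eqP => w0.
  have := Yw i; rewrite w0 mulmx0 => /matrixP/(_ i 0).
  by rewrite !mxE !eqxx /= => /eqP; rewrite eq_sym oner_eq0.
(* Cauchy-Schwarz for the form Y, applied to x and w i = Y^-1 e_i *)
have key (x : 'cV[R]_g) i : x i 0 ^+ 2 <= d i * (x^T *m Y *m x) 0 0.
  have := Yge0 (d i *: x - x i 0 *: w i).
  have -> : (d i *: x - x i 0 *: w i)^T = d i *: x^T - x i 0 *: (w i)^T.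
    by apply/matrixP => a b; rewrite !mxE.
  rewrite -mulmxA mulmxBr -!scalemxAr Yw.
  rewrite mulmxBl !mulmxBr -!scalemxAl -!scalemxAr !mulmxA.
  have eB (a b : 'M[R]_1) : (a - b) 0 0 = a 0 0 - b 0 0 by rewrite !mxE.
  have eZ k (a : 'M[R]_1) : (k *: a) 0 0 = k * a 0 0 by rewrite mxE.
  rewrite !(eB, eZ) !dotl wYE wi; set Q := (x^T *m Y *m x) 0 0 => h.
  (* The form at d x - x_i w expands to d (d Q - x_i^2), so the positive factor d can be divided
     out. *)
  rewrite -subr_ge0 -(pmulr_rge0 _ (d0 i)).
  by move: h; congr (_ <= _); ring.
pose s := \sum_i d i.
have s0 : 0 <= s by apply: sumr_ge0 => i _; exact: ltW.
have s1 : 0 < 1 + s by rewrite ltr_pwDl.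
exists (1 + s)^-1; split=> [|x]; first by rewrite invr_gt0.
rewrite ler_pdivrMl// mulrDl mul1r.
apply: (@le_trans _ _ (s * (x^T *m Y *m x) 0 0)); last by rewrite lerDr.
by rewrite mulr_suml ler_sum.
Qed.

End PosDef.

Section Quad.
Variables (R : realType) (g : nat).
Local Notation C := R[i].
Local Notation normc := (@Normc.normc R).
Implicit Types (m n : 'cV[int]_g) (tau : 'M[C]_g).

Definition quad tau m : C :=
  let x : 'cV[C]_g := map_mx intr m in (x^T *m tau *m x) 0 0.

Lemma quadE tau m :
  quad tau m = \sum_i \sum_j (m i 0)%:~R * (m j 0)%:~R * tau i j.
Proof.
rewrite /quad mxE exchange_big /=; apply: eq_bigr => j _.
rewrite mxE mulr_suml; apply: eq_bigr => i _.
by rewrite !mxE mulrAC.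
Qed.

Lemma Im_sum (I : Type) (r : seq I) (f : I -> C) :
  complex.Im (\sum_(i <- r) f i) = \sum_(i <- r) complex.Im (f i).
Proof. by elim/big_rec2: _ => //= i x y _ <-; case: (f i) y => [a b] []. Qed.

Lemma Im_int_mul (k : int) (z : C) :
  complex.Im (k%:~R * z) = k%:~R * complex.Im z.
Proof.
have -> : (k%:~R : C) = (k%:~R : R)%:C by rewrite rmorph_int.
by case: z => a b /=; rewrite mul0r addr0.
Qed.

Lemma siegel_Im_quad tau : siegel tau -> exists c : R, 0 < c /\
  forall m, c * sqnorm R m <= complex.Im (quad tau m).
Proof.
move=> [tauT taupos].
have [||c [c0 hc]] := @posdef_lower_bound R g (map_mx (@complex.Im R) tau).
- by rewrite matrix.map_trmx tauT.
- exact: taupos.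
exists c; split=> // m.
rewrite (le_trans _ (le_trans (hc (map_mx intr m)) _))//.
  by rewrite ler_wpM2l ?(ltW c0)//; apply: ler_sum => i _; rewrite mxE.
rewrite le_eqVlt; apply/orP; left; apply/eqP.
rewrite quadE Im_sum; under [RHS]eq_bigr do rewrite Im_sum.
rewrite mxE exchange_big /=; apply: eq_bigr => j _.
rewrite mxE mulr_suml; apply: eq_bigr => i _.
by rewrite !mxE -intrM Im_int_mul intrM mulrAC.
Qed.

Lemma quad_parallelogram tau m n :
  quad tau (m + n) + quad tau (m - n) = 2 * quad tau m + 2 * quad tau n.
Proof.
rewrite !quadE !mulr_sumr -!big_split /=; apply: eq_bigr => i _.
rewrite !mulr_sumr -!big_split /=; apply: eq_bigr => j _.
by rewrite !mxE !intrD !intrN; ring.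
Qed.

Definition gauss_term tau m : C := cexp ((pi : R)%:C * 'i * quad tau m).

Lemma gauss_term_bounded tau : siegel tau -> gauss_bounded (gauss_term tau).
Proof.
move=> /siegel_Im_quad[c [c0 hc]]; exists 1, (pi * c); split.
  by rewrite mulr_gt0 ?pi_gt0.
move=> m; rewrite mul1r normc_cexp ler_expR.
have -> : complex.Re ((pi : R)%:C * 'i * quad tau m) =
    - (pi * complex.Im (quad tau m)).
  by case: (quad tau m) => a b /=; ring.
by rewrite lerN2 -mulrA ler_wpM2l ?pi_ge0.
Qed.

End Quad.

(** * Some theta constant does not vanish *)

Section Signs.
Variables (R : realType) (g : nat).
Local Notation C := R[i].
Local Notation normc := (@Normc.normc R).
Implicit Types (m n : 'cV[int]_g) (z : 'cV[R]_g) (d : {ffun 'I_g -> bool}).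

Definition int_sign (k : int) : C := if odd (absz k) then -1 else 1.

Definition sign_char d m : C := \prod_i (if d i then int_sign (m i 0) else 1).

Definition pairing z m : R := \sum_i (m i 0)%:~R * z i 0.

Definition fourier_char z m : C := cexp ((2 * pi * pairing z m)%:C * 'i).

Definition half_vec d : 'cV[R]_g := \col_i (if d i then 2^-1 else 0).

Lemma cexp_pi_int (k : int) : cexp ((pi * k%:~R : R)%:C * 'i) = int_sign k.
Proof.
have cexp_pi : cexp ((pi : R)%:C * 'i) = -1.
  rewrite /cexp /= !(mul0r, mulr0, mulr1, subr0, addr0) cospi sinpi expR0.
  by rewrite mul1r; apply/eqP; rewrite eq_complex /= oppr0 !eqxx.
have cexp_pi_nat (n : nat) : cexp ((pi * n%:R : R)%:C * 'i) = int_sign n.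
  elim: n => [|n ih]; first by rewrite mulr0 mul0r cexp0.
  rewrite -natr1 mulrDr mulr1 rmorphD mulrDl cexpD ih cexp_pi /int_sign /=.
  by case: (odd n) => /=; ring.
case: (intP k) => [|n|n]; first exact: (cexp_pi_nat 0%N).
  exact: cexp_pi_nat.
have sq : int_sign n.+1 * int_sign n.+1 = 1.
  by rewrite /int_sign; case: ifP => _; ring.
rewrite [RHS](_ : _ = int_sign n.+1); last by rewrite /int_sign abszN.
rewrite -[LHS]mulr1 -sq mulrA -{1}cexp_pi_nat -cexpD.
rewrite mulrNz mulrN rmorphN mulNr.
by rewrite addNr cexp0 mul1r.
Qed.

Lemma fourier_charD z w m :
  fourier_char (z + w) m = fourier_char z m * fourier_char w m.
Proof.
have E : pairing (z + w) m = pairing z m + pairing w m.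
  by rewrite -big_split; apply: eq_bigr => i _; rewrite mxE mulrDr.
by rewrite /fourier_char E mulrDr rmorphD mulrDl cexpD.
Qed.

Lemma fourier_charDr z m n :
  fourier_char z (m + n) = fourier_char z m * fourier_char z n.
Proof.
have E : pairing z (m + n) = pairing z m + pairing z n.
  by rewrite -big_split; apply: eq_bigr => i _; rewrite mxE intrD mulrDl.
by rewrite /fourier_char E mulrDr rmorphD mulrDl cexpD.
Qed.

Lemma fourier_char0 m : fourier_char 0 m = 1.
Proof.
rewrite /fourier_char /pairing big1 ?mulr0 ?mul0r ?cexp0// => i _.
by rewrite mxE mulr0.
Qed.

Lemma normc_fourier_char z m : normc (fourier_char z m) = 1.
Proof. by rewrite normc_cexp /= mul0r mulr0 subrr expR0. Qed.

Lemma fourier_char_half d m : fourier_char (half_vec d) m = sign_char d m.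
Proof.
rewrite /fourier_char /pairing mulr_sumr rmorph_sum mulr_suml.
rewrite (big_morph _ (@cexpD R) (@cexp0 R)); apply: eq_bigr => i _.
rewrite mxE; case: (d i); last by rewrite !mulr0 mul0r cexp0.
rewrite -cexp_pi_int (_ : _ * _ = pi * (m i 0)%:~R)//; by field.
Qed.

Lemma normc_sign_char d m : normc (sign_char d m) = 1.
Proof. by rewrite -fourier_char_half normc_fourier_char. Qed.

Lemma sign_charD d m n : sign_char d (m + n) = sign_char d m * sign_char d n.
Proof. by rewrite -!fourier_char_half fourier_charDr. Qed.

Lemma sum_sign_char m : \sum_d sign_char d m =
  \prod_i (if odd (absz (m i 0%R)) then 0 else 2).
Proof.
rewrite -(bigA_distr_bigA (fun i (b : bool) =>
  if b then int_sign (m i 0) else 1)) /=.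
apply: eq_bigr => i _; rewrite big_bool /int_sign /=.
by case: ifP => _; ring.
Qed.

(** Orthogonality of characters modulo 2: summed over the 2^g sign characters, the hypotheses give
    2^g f on 2 Z^g and 0 elsewhere. What remains is reindexed by doubling, with the floor of m / 2
    as left inverse. *)
Lemma has_sum_even (f : 'cV[int]_g -> C) :
  (forall d, has_sum (fun m => f m * sign_char d m) 0) ->
  has_sum (fun m => f (m *+ 2)) 0.
Proof.
move=> h; have := has_sum_fin (index_enum {ffun 'I_g -> bool}) h.
rewrite big1// => hs.
pose halve m : 'cV[int]_g := \col_i (m i 0%R %/ 2)%Z.
have halveK : cancel (fun m => m *+ 2) halve.
  move=> m; apply/matrixP => i j; rewrite ord1 mxE mulmxnE.
  by rewrite -[_ *+ 2]mulr_natr mulzK.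
have halve_supp m : halve m *+ 2 != m -> \sum_d f m * sign_char d m = 0.
  move=> hm; rewrite -mulr_sumr sum_sign_char.
  have [i oi] : exists i, odd (absz (m i 0%R)).
    apply/existsP; apply: contraR hm; rewrite negb_exists => /forallP hm.
    apply/eqP/matrixP => i j; rewrite ord1 mulmxnE mxE.
    have := hm i; set k := m i 0; lia.
  by rewrite (bigD1 i)//= oi mul0r mulr0.
have := has_sumZ (2 ^+ g)^-1 (has_sum_comp_can halveK halve_supp hs).
rewrite mulr0; apply: has_sum_eq => m /=.
rewrite -mulr_sumr sum_sign_char (eq_bigr (fun=> 2)); last first.
  by move=> i _; rewrite mulmxnE; case: ifP => //; lia.
rewrite prodr_const card_ord mulrC -mulrA divff ?mulr1// expf_neq0//.
Qed.

Lemma fourier_char_double z m :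
  fourier_char (2^-1 *: z) (m *+ 2) = fourier_char z m.
Proof.
rewrite /fourier_char (_ : pairing _ _ = pairing z m)//.
by apply: eq_bigr => i _; rewrite mulr2n !mxE intrD; field.
Qed.

(* Averaging over the translates of z by half-integer vectors kills all the
   coefficients outside 2 Z^g; iterating leaves f 0 and a tail of f. *)
Lemma fourier_coef0_eq0 (f : 'cV[int]_g -> C) : abs_summable f ->
  (forall z, has_sum (fun m => f m * fourier_char z m) 0) -> f 0 = 0.
Proof.
move=> fs hf.
have dyadic k : has_sum (fun m => f (m *+ 2 ^ k)) 0.
  suff: forall z, has_sum (fun m => f (m *+ 2 ^ k) * fourier_char z m) 0.
    by move/(_ 0); apply: has_sum_eq => m; rewrite fourier_char0 mulr1.
  elim: k => [|k ih] z; first by apply: has_sum_eq (hf z) => m; rewrite expn0.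
  have /has_sum_even : forall d, has_sum (fun m =>
      (f (m *+ 2 ^ k) * fourier_char (2^-1 *: z) m) * sign_char d m) 0.
    (* Translation by d / 2 produces the sign, and z is halved because the doubling of m will
       restore it. *)
    move=> d; apply: has_sum_eq (ih (2^-1 *: z + half_vec d)) => m.
    by rewrite fourier_charD fourier_char_half mulrA.
  apply: has_sum_eq => m.
  by rewrite fourier_char_double -mulrnA -expnS.
apply: normc_eq0 => e e0; have e20 : 0 < e / 2 by rewrite divr_gt0.
have [A hA] := abs_summable_tail fs e20.
(* With 2^k larger than every entry of every member of A, a nonzero multiple of 2^k cannot belong to
   A, so those terms belong to the tail. *)
have [k hk] : exists k : nat, forall m i, m \in A -> (absz (m i 0%R) < 2 ^ k)%N.
  exists (\sum_(m <- A) \sum_i absz (m i 0%R))%N => m i mA.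
  rewrite (leq_ltn_trans _ (ltn_expl _ _))//.
  rewrite (big_fsetD1 m)//= (bigD1 i)//= -addnA.
  exact: leq_addr.
have [A' hA'] := dyadic k _ e20.
have := hA' (0 |` A')%fset (fsubsetUr _ _); rewrite subr0.
rewrite (big_fsetD1 0) ?fset1U1//= mul0rn.
set B := (_ `\ _)%fset; set S := \sum_(m <- B) _ => hS.
rewrite [e]splitr (_ : f 0 = (f 0 + S) - S); last by ring.
rewrite (le_trans (normcD _ _))// lerD// normcN.
rewrite (le_trans (normc_sum _ _))//.
have inj_p : injective (fun m : 'cV[int]_g => m *+ 2 ^ k).
  move=> m n /matrixP mn; apply/matrixP => i j; have := mn i j.
  by rewrite !mulmxnE; apply: pmulrnI; rewrite expn_gt0.
rewrite (le_trans _ (hA ((fun m : 'cV[int]_g => m *+ 2 ^ k) @` B)%fset _))//.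
  by rewrite [leRHS]big_imfset//= => x y _ _; exact: inj_p.
apply/fsetP => m; rewrite !inE; apply/negP => /andP[mA /imfsetP[n /=]].
rewrite !inE => /andP[n0 _] mn; move/negP: n0; apply.
apply/eqP/matrixP => i j; rewrite ord1 [RHS]mxE.
have := expn_gt0 2 k; have := hk m i mA; rewrite mn mulmxnE.
set x := n i 0; set N := (2 ^ k)%N; rewrite -mulr_natr abszM => xN N0.
by apply/eqP; rewrite -absz_eq0; nia.
Qed.

End Signs.

Section NonVanishing.
Variables (R : realType) (g : nat).
Local Notation C := R[i].
Local Notation normc := (@Normc.normc R).
Implicit Types (m n u : 'cV[int]_g) (tau : 'M[C]_g) (d : {ffun 'I_g -> bool}).

Lemma theta_term0E (del : 'cV['Z_2]_g) tau z m :
  theta_term 0 del tau z m = gauss_term tau m *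
    cexp ((pi : R)%:C * 'i *
      (2 * \sum_i (m i 0)%:~R * (z i 0 + half_char R del i 0))).
Proof.
rewrite /theta_term (_ : half_char R 0 = 0 :> 'cV_g); last first.
  by apply/matrixP => i j; rewrite !mxE mulr0.
rewrite addr0 mulrDr cexpD; congr (_ * cexp (_ * (2 * _))).
rewrite mxE; apply: eq_bigr => i _.
by rewrite !mxE.
Qed.

(** Boolean functions index the characteristics so that a sum over all of them expands into a
    product over the coordinates, as in [sum_sign_char]. *)
Definition Z2_vec d : 'cV['Z_2]_g := \col_i (if d i then 1 else 0).

Lemma theta_term_Z2_vec d tau m :
  theta_term 0 (Z2_vec d) tau 0 m = gauss_term tau m * sign_char R d m.
Proof.
rewrite theta_term0E -fourier_char_half; congr (_ * cexp _).
rewrite (_ : \sum_i _ = (pairing (half_vec R d) m)%:C).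
  by rewrite !rmorphM rmorph_nat; ring.
rewrite rmorph_sum; apply: eq_bigr => i _.
rewrite rmorphM /= rmorph_int !mxE add0r; congr (_ * _).
by case: (d i); rewrite ?mulr0// mulr1 fmorphV rmorph_nat.
Qed.

(* The parallelogram law for m and u - m, whose sum is u and whose difference
   lies in the coset u + 2 Z^g. *)
Lemma double_gauss_prod tau m u :
  gauss_term tau m * gauss_term tau m *
    (gauss_term tau (u - m) * gauss_term tau (u - m)) =
  gauss_term tau u * gauss_term tau (m *+ 2 - u).
Proof.
rewrite -!cexpD -!mulrDr; congr (cexp (_ * _)).
have := quad_parallelogram tau m (m - u).
rewrite (_ : m + (m - u) = m *+ 2 - u); last by rewrite mulr2n addrA.
rewrite (_ : m - (m - u) = u); last by rewrite subKr.
have quadN v : quad tau (- v) = quad tau v.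
  rewrite !quadE; apply: eq_bigr => i _; apply: eq_bigr => j _.
  by rewrite !mxE !intrN mulrNN.
rewrite -(quadN (m - u)) opprB => h.
by rewrite [RHS]addrC h !mulr_natl !mulr2n.
Qed.

Lemma exists_theta_const_neq0 tau : siegel tau ->
  exists d, theta_const 0 (Z2_vec d) tau != 0.
Proof.
move=> tauS; apply/not_existsP => th0.
set a := gauss_term tau.
have ha : gauss_bounded a := gauss_term_bounded tauS.
have [K [c [c0 hK]]] := ha.
have as_ := gauss_bounded_summable ha.
(* A zero value of [sum] says nothing about convergence, so a sum s is obtained from absolute
   summability first and then identified with the vanishing theta constant. *)
have sums0 d : has_sum (fun m => a m * sign_char R d m) 0.
  have [s hs] : exists s, has_sum (fun m => a m * sign_char R d m) s.
    apply: abs_summable_has_sum; apply: abs_summable_le as_ => m.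
    by rewrite (Normc.normcM (a m)) normc_sign_char mulr1.
  suff -> : 0 = s by [].
  apply/esym/eqP; apply: contraT => s0; case: (th0 d).
  rewrite /theta_const /theta (_ : theta_term _ _ _ _ =
    fun m => a m * sign_char R d m) ?(has_sum_sum hs)//.
  by apply/funext => m; exact: theta_term_Z2_vec.
(* Shifting the index by u multiplies the sum twisted by the character d only by the sign of u, so
   the shifted family satisfies the hypothesis of [has_sum_even] too. *)
have coset0 u : has_sum (fun m => a (m *+ 2 - u)) 0.
  apply: (@has_sum_even R g (fun m => a (m - u))) => d.
  have shiftK : cancel (fun m => m - u) (fun m => m + u).
    by move=> m; rewrite subrK.
  have := has_sumZ (sign_char R d u) (has_sum_comp_can shiftK _ (sums0 d)).
  rewrite mulr0 => h; apply: has_sum_eq (h _) => [m|m] /=; last first.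
    by rewrite addrK eqxx.
  have E : sign_char R d m = sign_char R d (m - u) * sign_char R d u.
    by rewrite -sign_charD subrK.
  by rewrite E; ring.
pose b z m := a m * a m * fourier_char z m.
have bs z : abs_summable (b z).
  (* One of the two factors a m is bounded by K, because its Gaussian bound never exceeds K. *)
  apply: abs_summable_le (abs_summableZ K%:C as_) => m.
  rewrite (Normc.normcM (a m * a m)) normc_fourier_char mulr1.
  rewrite (Normc.normcM (a m)) (Normc.normcM _ (a m)) normc_real.
  rewrite ler_wpM2r ?normc_ge0// (le_trans (hK m))//.
  rewrite (le_trans (ler_wpM2r (expR_ge0 _) (ler_norm K)))//.
  by rewrite ler_piMr// expR_le1 oppr_le0 mulr_ge0 ?sqnorm_ge0// ltW.
(* S * S, summed along the lines m + n = u, is a combination of the coset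
   sums, which vanish. *)
have b0 z : has_sum (b z) 0.
  have [S hS] := abs_summable_has_sum (bs z).
  have Ps := abs_summable_prod (bs z) (bs z).
  have [s hs] := abs_summable_has_sum Ps.
  have s_SS : s = S * S.
    have h1 := has_sum_sigma Ps hs (fun m => has_sumZ (b z m) hS).
    apply: has_sum_unique h1 _.
    by apply: has_sum_eq (has_sumZ S hS) => m; rewrite mulrC.
  (* The pair (u, m) stands for (m, u - m), so that row u of the reindexed product family is the
     line of pairs with sum u. *)
  pose p (x : 'cV[int]_g * 'cV[int]_g) := (x.2, x.1 - x.2).
  pose q (x : 'cV[int]_g * 'cV[int]_g) := (x.1 + x.2, x.1).
  have pK : cancel p q by move=> [x y]; rewrite /p /q /= addrC subrK.
  have qK : cancel q p by move=> [x y]; rewrite /p /q /= addrC addKr.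
  have p0 x : p (q x) != x -> b z x.1 * b z x.2 = 0 by rewrite qK eqxx.
  have h2 := has_sum_comp_can pK p0 hs.
  have h3 := abs_summable_comp_inj (can_inj pK) Ps.
  have s0 : s = 0.
    have := has_sum_sigma (t := fun=> 0) h3 h2.
    move=> h4; apply: has_sum_unique (h4 _) _ => [u|].
      have := has_sumZ (a u * fourier_char z u) (coset0 u).
      rewrite mulr0; apply: has_sum_eq => m /=.
      have Eu : fourier_char z u = fourier_char z (u - m) * fourier_char z m.
        by rewrite -fourier_charDr subrK.
      rewrite Eu mulrAC -double_gauss_prod -/a /b; ring.
    have := has_sumZ 0 hS; rewrite mul0r; apply: has_sum_eq => m.
    by rewrite mul0r.
  have S0 : S = 0.
    by apply/eqP; rewrite -sqrf_eq0 expr2 -s_SS s0.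
  by rewrite -S0.
have : a 0 * a 0 = 0.
  apply: (@fourier_coef0_eq0 R g (fun m => a m * a m)) => //.
  have := bs 0; apply: abs_summable_le => m.
  by rewrite /b fourier_char0 mulr1.
rewrite /a /gauss_term (_ : quad tau 0 = 0); last first.
  by rewrite quadE big1// => i _; rewrite big1// => j _; rewrite mxE !mul0r.
by rewrite mulr0 cexp0 mulr1 => /eqP; rewrite oner_eq0.
Qed.

End NonVanishing.

(** * The heat equation *)

Section Heat.
Variables (R : realType) (g : nat).
Local Notation C := R[i].
Local Notation normc := (@Normc.normc R).
Implicit Types (m : 'cV[int]_g) (tau : 'M[C]_g) (i j k : 'I_g).

Lemma normc_int (n : int) : normc (n%:~R : C) = `|(n%:~R : R)|.
Proof. by rewrite (_ : n%:~R = (n%:~R : R)%:C) ?normc_real ?rmorph_int. Qed.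

Lemma normc_pi_i : normc ((pi : R)%:C * 'i) = pi.
Proof. by rewrite Normc.normcM normci normc_real mulr1 ger0_norm ?pi_ge0. Qed.

Lemma sqr_coord_le_sqnorm m i : ((m i 0)%:~R : R) ^+ 2 <= sqnorm R m.
Proof.
rewrite /sqnorm (bigD1 i)//= lerDl sumr_ge0// => k _; exact: sqr_ge0.
Qed.

(** An integer satisfies |k| <= k^2, so the linear exponents of the z-derivatives also meet the
    quadratic bound required of b. *)
Lemma coord_le_sqnorm m i : `|((m i 0)%:~R : R)| <= sqnorm R m.
Proof.
rewrite (le_trans _ (sqr_coord_le_sqnorm m i))//.
rewrite -real_normK ?num_real// -intr_norm expr2 -intrM ler_int.
set x := m i 0; nia.
Qed.

Lemma coordM_le_sqnorm m i j :
  `|((m i 0)%:~R * (m j 0)%:~R : R)| <= 2 * sqnorm R m.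
Proof.
have := sqr_coord_le_sqnorm m i; have := sqr_coord_le_sqnorm m j.
set x : R := _%:~R; set y : R := (m j 0)%:~R => hy hx.
rewrite ler_norml; apply/andP; split; nra.
Qed.

Definition coord_exponent i m : C := (pi : R)%:C * 'i * (2 * (m i 0)%:~R).

Lemma coord_exponent_le i m :
  normc (coord_exponent i m) <= (2 * pi) * sqnorm R m.
Proof.
rewrite Normc.normcM normc_pi_i (Normc.normcM 2) normc_int.
have -> : normc 2 = 2.
  rewrite (_ : 2 = (2 : R)%:C) ?normc_real ?normr_nat//.
  by rewrite rmorph_nat.
rewrite mulrA [pi * 2]mulrC ler_wpM2l ?coord_le_sqnorm// mulr_ge0 ?pi_ge0//.
Qed.

(** The two shifts stay separate exponential factors: the one in s is absorbed into the coefficients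
    while differentiating in h. *)
Lemma theta_shift tau i j (s h : C) :
  theta 0 0 tau (h *: delta_mx j 0 + s *: delta_mx i 0) =
  sum ((fun m => gauss_term tau m * cexp (s * coord_exponent i m) *
     cexp (h * coord_exponent j m)) : _ -> C^o).
Proof.
congr sum; apply/funext => m; rewrite theta_term0E -[RHS]mulrA -cexpD.
congr (_ * cexp _).
have E k (t : C) : \sum_l (m l 0)%:~R * (t *: (delta_mx k 0 : 'cV[C]_g)) l 0 =
    t * (m k 0)%:~R.
  rewrite (bigD1 k)//= big1 => [|l lk]; rewrite !mxE ?eqxx ?(negbTE lk).
    by rewrite addr0 mulr1 mulrC.
  by rewrite !mulr0.
rewrite (_ : \sum_l _ = h * (m j 0)%:~R + s * (m i 0)%:~R).
  by rewrite /coord_exponent; ring.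
rewrite -!E -big_split /=; apply: eq_bigr => l _.
by rewrite !mxE !mulr0 addr0 mulrDr.
Qed.

Lemma theta_hessian00E tau i j : siegel tau -> theta_hessian 0 0 tau i j =
  sum ((fun m => gauss_term tau m * coord_exponent j m * coord_exponent i m)
    : _ -> C^o).
Proof.
move=> tauS; have ha := gauss_term_bounded tauS.
have hi := coord_exponent_le i; have hj := coord_exponent_le j.
(* The outer derivative needs the inner one at all points h e_i near 0. For |h| <= r the
   coefficients twisted by the outer shift are still Gaussian bounded, so the inner series can be
   differentiated there. *)
have [r [r0 hr]] := gauss_bounded_exp ha hi.
rewrite /theta_hessian mxE.
apply: (derive_exp_series (gauss_bounded_mul ha hj) hi r0) => h hh.
pose a m := gauss_term tau m * cexp (h * coord_exponent i m).
rewrite addr0 (derive_exp_series (a := a) _ hj ltr01).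
- by congr sum; apply/funext => m; rewrite mulrAC.
- apply: gauss_bounded_le hr => m.
  rewrite !(Normc.normcM (gauss_term tau m)) ler_wpM2l ?normc_ge0//.
  rewrite normc_cexp normc_real (ger0_norm (expR_ge0 _)) ler_expR.
  rewrite (le_trans (ler_norm _))// (le_trans (normc_ge_Re _))//.
  by rewrite Normc.normcM ler_wpM2r ?normc_ge0.
- by move=> t _; exact: theta_shift.
Qed.

(* the direction in which dtau i j differentiates *)
Definition sym_delta i j : 'M[C]_g :=
  if i == j then delta_mx i i else delta_mx i j + delta_mx j i.

Lemma quad_delta i j m :
  quad (delta_mx i j : 'M[C]_g) m = (m i 0)%:~R * (m j 0)%:~R.
Proof.
rewrite quadE (bigD1 i)//= (bigD1 j)//= !big1 ?addr0.
- by rewrite !mxE !eqxx mulr1.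
- by move=> l li; rewrite big1// => k _; rewrite !mxE (negbTE li) mulr0.
- by move=> l lj; rewrite !mxE (negbTE lj) andbF mulr0.
Qed.

Lemma quadDZ (t : C) (A B : 'M[C]_g) m :
  quad (t *: A + B) m = t * quad A m + quad B m.
Proof.
rewrite !quadE mulr_sumr -big_split; apply: eq_bigr => i _ /=.
rewrite mulr_sumr -big_split; apply: eq_bigr => j _ /=.
by rewrite !mxE; ring.
Qed.

(** Off the diagonal the symmetric direction contributes m_i m_j twice, which the weight 1/2 in the
    operator D undoes. *)
Lemma quad_sym_delta i j m : (1 + (i == j)%:R) / 2 * quad (sym_delta i j) m =
  (m i 0)%:~R * (m j 0)%:~R.
Proof.
rewrite /sym_delta; case: eqP => [->|_] /=.
  by rewrite quad_delta; field.
by rewrite -[delta_mx i j]scale1r quadDZ !quad_delta; field.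
Qed.

(** On the m-th term the Hessian acts by (2 pi i m_i)(2 pi i m_j) and D by pi i m_i m_j; their ratio
    is 4 pi i. *)
Lemma theta_heat tau i j : siegel tau ->
  theta_hessian 0 0 tau i j =
    4 * ((pi : R)%:C * 'i) * Dop (theta_const 0 0) tau i j.
Proof.
move=> tauS; have ha := gauss_term_bounded tauS.
pose b m : C := (pi : R)%:C * 'i * quad (sym_delta i j) m.
have hb m : normc (b m) <= (4 * pi) * sqnorm R m.
  rewrite Normc.normcM normc_pi_i.
  rewrite (_ : 4 * pi * _ = pi * (4 * sqnorm R m)); last by ring.
  rewrite ler_wpM2l ?pi_ge0//.
  have hc k l : normc ((m k 0)%:~R * (m l 0)%:~R) <= 2 * sqnorm R m.
    by rewrite Normc.normcM !normc_int -normrM coordM_le_sqnorm.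
  rewrite /sym_delta; case: ifP => _.
    rewrite quad_delta (le_trans (hc _ _))// ler_wpM2r ?sqnorm_ge0//.
    by rewrite ler_nat.
  rewrite -[delta_mx i j]scale1r quadDZ !quad_delta mul1r.
  rewrite (le_trans (normcD _ _))// (le_trans (lerD (hc _ _) (hc _ _)))//.
  by rewrite -mulrDl -natrD.
rewrite theta_hessian00E// mxE /dtau -/(sym_delta i j).
(* The shifted series agrees term by term with the twisted one for every h, so no convergence at the
   shifted matrix is at stake and the radius 1 is arbitrary. *)
rewrite (@derive_exp_series R g _ _ _ _ _ _ _ 1 ha hb ltr01); last first.
  move=> h _; congr sum; apply/funext => m.
  rewrite theta_term0E big1 ?mulr0 ?cexp0 ?mulr1.
    rewrite /gauss_term quadDZ mulrDr cexpD mulrC; congr (_ * cexp _).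
    by rewrite /b; ring.
  by move=> k _; rewrite !mxE mulr0 addr0 mulr0.
have [s hs] :=
  abs_summable_has_sum (gauss_bounded_summable (gauss_bounded_mul ha hb)).
rewrite (has_sum_sum hs); apply: has_sum_sum.
have := has_sumZ (4 * ((pi : R)%:C * 'i) * ((1 + (i == j)%:R) / 2)) hs.
rewrite -[X in has_sum _ X]mulrA; apply: has_sum_eq => m /=.
rewrite /b /coord_exponent.
transitivity (4 * ((pi : R)%:C * 'i) * ((pi : R)%:C * 'i) * gauss_term tau m *
  ((1 + (i == j)%:R) / 2 * quad (sym_delta i j) m)).
  by move: (gauss_term tau m) => x; ring.
by rewrite quad_sym_delta; move: (gauss_term tau m) => x; ring.
Qed.

End Heat.

(** * Rank and minors in lexicographic order *)

Section Minors.
Variables (F : fieldType) (g : nat).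
Implicit Types A : 'M[F]_g.

Lemma row_free_rowsub (m n k : nat) (B : 'M[F]_(m, n)) (f : 'I_k -> 'I_m) :
  injective f -> row_free B -> row_free (rowsub f B).
Proof.
move=> inj_f /row_freeP[D BD]; apply/row_freeP; exists (colsub f D).
rewrite -mxsub_mul BD; apply/matrixP => i j.
by rewrite !mxE (inj_eq inj_f).
Qed.

(** First k independent rows of A, then k independent columns of the resulting matrix, which has
    rank k. *)
Lemma unit_submx_of_rank A k : (k <= \rank A)%N ->
  exists f f' : 'I_k -> 'I_g,
    [/\ injective f, injective f' & mxsub f f' A \in unitmx].
Proof.
move=> kr; pose f : 'I_k -> 'I_g := maxrankfun A \o widen_ord kr.
have inj_f : injective f.
  move=> i j /maxrankfun_inj /(congr1 val) /= ij; exact: val_inj.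
have Bfree : row_free (rowsub f A).
  rewrite rowsub_comp; apply: row_free_rowsub (maxrowsub_free A).
  by move=> i j /(congr1 val) /= ij; exact: val_inj.
have BTfull : row_full (rowsub f A)^T by rewrite /row_full mxrank_tr.
exists f, (fullrankfun BTfull); split=> //; first exact: fullrankfun_inj.
have -> : mxsub f (fullrankfun BTfull) A =
    (rowsub (fullrankfun BTfull) (rowsub f A)^T)^T.
  by apply/matrixP => i j; rewrite !mxE.
by rewrite unitmx_tr fullrowsub_unit.
Qed.

(** Sorting the values of f gives an increasing tuple, hence an entry of the lexicographic list; s
    is the permutation that undoes the sorting. *)
Lemma lex_subset_of_inj k (f : 'I_k -> 'I_g) : injective f ->
  exists (a : 'I_('C(g, k))) (s : {perm 'I_k}), f =1 tnth (lex_subset a) \o s.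
Proof.
move=> inj_f; pose le (i j : 'I_g) := (i <= j)%N.
pose s0 := [tuple f i | i < k].
pose t : k.-tuple 'I_g := [tuple of sort le s0].
have tP : t \in incr_tuples g k.
  rewrite inE ltn_sorted_uniq_leq map_inj_uniq; last exact: val_inj.
  rewrite sort_uniq map_inj_uniq ?enum_uniq//=.
  rewrite sorted_map; apply: sort_sorted => i j; exact: leq_total.
have /tuple_permP[s hs] : perm_eq s0 t by rewrite perm_sym perm_sort.
pose t' : k.-tuplelexi 'I_g := t; pose a := Order.enum_rank_in tP t'.
exists (cast_ord (card_incr_tuples g k) a), s => i /=.
rewrite /lex_subset cast_ordK Order.EnumVal.enum_rankK_in//.
have -> : f i = tnth s0 i by rewrite tnth_mktuple.
have -> : s0 = [tuple tnth t (s i) | i < k] by apply: val_inj.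
by rewrite tnth_mktuple.
Qed.

Lemma minors_mx_eq0 A k : (minors_mx k.+1 A == 0) = (\rank A <= k)%N.
Proof.
apply/eqP/idP => [A0|rk].
  rewrite leqNgt; apply/negP => /unit_submx_of_rank[f [f' [inj_f inj_f']]].
  have [a [s fE]] := lex_subset_of_inj inj_f.
  have [b [s' f'E]] := lex_subset_of_inj inj_f'.
  (* Sorting rows and columns amounts to multiplying by permutation matrices, so the determinant of
     this invertible submatrix is a multiple of one lexicographic minor, which is 0. *)
  rewrite (eq_mxsub _ _ fE f'E) mxsub_comp mxsubrc -row_permEsub -col_permEsub.
  rewrite row_permE col_permE unitmxE !det_mulmx.
  have /matrixP/(_ a b) := A0; rewrite !mxE => ->.
  by rewrite mul0r mulr0 unitr0.
apply/matrixP => a b; rewrite !mxE; apply/eqP; apply: contraTT rk => det0.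
rewrite -ltnNge.
have : \rank (mxsub (tnth (lex_subset a)) (tnth (lex_subset b)) A) = k.+1.
  by apply: mxrank_unit; rewrite unitmxE unitfE.
move=> <-; rewrite mxsubrc (leq_trans (mxrankS (rowsub_sub _ _)))//.
rewrite -mxrank_tr trmx_mxsub (leq_trans (mxrankS (rowsub_sub _ _)))//.
by rewrite mxrank_tr.
Qed.

End Minors.

(** * The equivalence at each point and its passage to the quotient *)

Unset Implicit Arguments.
Set Strict Implicit.
Set Printing Implicit Defensive.

Theorem theorem9 (R : realType) (g h : nat) (hg : (h < g)%N) :
  let equations (tau : 'M[R[i]]_g) : Prop :=
    theta 0 0 tau 0 = 0 /\
    forall eps del : 'cV['Z_2]_g,
      even_char eps del -> (eps, del) != (0, 0) -> Bform eps del h.+1 tau = 0 in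
  (* at every point of the half-space, hence for every representative of a
     point of the quotient *)
  (forall tau : 'M[R[i]]_g, siegel tau ->
     (hessian_rank_le h tau <-> equations tau)) /\
  (* on the quotient *)
  theta0_rank h = Ag48_locus equations.
Proof.
move=> equations.
have pointwise (tau : 'M[R[i]]_g) : siegel tau ->
    (hessian_rank_le h tau <-> equations tau).
  move=> tauS; pose D := Dop (theta_const 0 0) tau.
  have heatE : theta_hessian 0 0 tau = (4 * ((pi : R)%:C * 'i)) *: D.
    by apply/matrixP => i j; rewrite theta_heat// [RHS]mxE.
  have c0 : 4 * ((pi : R)%:C * 'i) != 0 :> R[i].
    rewrite !mulf_neq0//.
      by apply/eqP => -[] /eqP; rewrite gt_eqF ?pi_gt0.
    by apply/eqP => -[] /eqP; rewrite oner_eq0.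
  have rankE : (\rank (theta_hessian 0 0 tau) <= h)%N = (\rank D <= h)%N.
    by rewrite heatE (eqmx_scale _ c0).
  have BE eps del : theta_const 0 0 tau = 0 ->
      Bform eps del h.+1 tau = minors_mx h.+1 (theta_const eps del tau *: D).
    by move=> th0; rewrite /Bform th0 scale0r subr0.
  split=> -[th0].
    rewrite rankE => rD; split=> // eps del _ _; rewrite BE//.
    by apply/eqP; rewrite minors_mx_eq0 (leq_trans (mxrank_scale _ _)).
  move=> heq; split=> //; rewrite rankE.
  have [d thd] := exists_theta_const_neq0 tauS.
  have := heq 0 (Z2_vec d); rewrite BE// => /(_ _ _)/eqP.
  rewrite minors_mx_eq0 (eqmx_scale _ thd); apply.
    by rewrite /even_char big1// => i _; rewrite mxE mul0r.
  (* The characteristic found differs from [0, 0] because theta[0, 0] vanishes at tau and its theta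
     constant does not. *)
  by apply: contra thd => /eqP[->]; apply/eqP.
split=> //; apply/seteqP; split=> x [xA [tau [tauS tx P]]]; split=> //;
  by exists tau; split=> //; apply/(pointwise _ tauS).
Qed.
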